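(* For every complex number $q$ with $|q|<1$, $$\sum_{n=0}^\infty \frac{q^{n(n-1)}(-q;q^2)_n}{(q;q)_{2n}} = \frac{f(1,q^2)}{\psi(-q)} = (-q;q)_\infty(-1;q^2)_\infty .$$
   Context: Notation: $(a;q)_n=\prod_{j=0}^{n-1}(1-aq^j)$ (so $(a;q)_0=1$) and $(a;q)_\infty=\prod_{j=0}^\infty(1-aq^j)$; the base may be replaced by a power of $q$. Ramanujan's theta function is $f(a,b)=\sum_{n=-\infty}^\infty a^{n(n+1)/2}b^{n(n-1)/2}$ for $|ab|<1$ (with $0^0=1$), and $\psi(q)=f(q,q^3)$; $\psi(-q)$ is $\psi$ evaluated at $-q$. *)

(* Defs.v *)
From HB Require Import structures.
From mathcomp Require Import all_boot all_order all_algebra.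
From mathcomp Require Import complex.
From mathcomp Require Import all_classical all_reals all_analysis.
Set Implicit Arguments.
Unset Strict Implicit.
Unset Printing Implicit Defensive.
Import Order.TTheory GRing.Theory Num.Theory.
Import numFieldNormedType.Exports.
Local Open Scope classical_set_scope.
Local Open Scope ring_scope.

(* Everything is stated over a generic [numFieldType], whose topology is the
   one given by its norm; it is then used with the complex numbers [R[i]]. *)

(* (a; q)_n *)
Definition qpoch (K : numFieldType) (a q : K) (n : nat) : K :=
  \prod_(j < n) (1 - a * q ^+ j).

(* (a; q)_oo *)
Definition qpoch_inf (K : numFieldType) (a q : K) : K :=
  limn (fun n : nat => qpoch a q n).

(* The exponents n(n+1)/2 and n(n-1)/2 are nonnegative integers for every
   n : int, so taking [absz] of the exact quotients loses nothing. *)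
Definition theta_term (K : numFieldType) (a b : K) (n : int) : K :=
  a ^+ `|(n * (n + 1) %/ 2)%Z|%N * b ^+ `|(n * (n - 1) %/ 2)%Z|%N.

(* Ramanujan's f(a, b).  The bilateral series is the sum of the series over
   n >= 0 and of the series over n < 0; [Negz n] is the integer -(n + 1). *)
Definition ramanujan_theta (K : numFieldType) (a b : K) : K :=
  limn (series (fun n : nat => theta_term a b (Posz n)))
  + limn (series (fun n : nat => theta_term a b (Negz n))).

Definition ramanujan_psi (K : numFieldType) (q : K) : K :=
  ramanujan_theta q (q ^+ 3).

(* Main.v *)
Require Import Defs.
From HB Require Import structures.
From mathcomp Require Import all_boot all_order all_algebra.
From mathcomp Require Import complex.
From mathcomp Require Import all_classical all_reals all_analysis.
From mathcomp Require Import ring zify.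
Import Order.TTheory GRing.Theory Num.Theory.
Import numFieldNormedType.Exports.
Set Implicit Arguments.
Unset Strict Implicit.
Unset Printing Implicit Defensive.
Local Open Scope classical_set_scope.
Local Open Scope ring_scope.
Local Open Scope complex_scope.

(** Each of the three expressions equals (-1; q^2)_oo / (q; q^2)_oo.

    The series is an instance, with base Q = q^2, a = -q and t = -1, of the
    summation of 1phi1,
      sum_n (-t)^n Q^(n(n-1)/2) (a; Q)_n / ((Q; Q)_n (a t; Q)_n)
        = (t; Q)_oo / (a t; Q)_oo,
    since (q; q)_2n = (q; q^2)_n (q^2; q^2)_n  ([sum_1phi1]).  The two theta
    functions are products by Jacobi's triple product identity
    ([jacobi_triple]): f(1, q^2) = (-1; q^2)_oo (q^4; q^4)_oo and
    psi(-q) = (q; q^2)_oo (q^4; q^4)_oo, after merging factors.  Finally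
    Euler's identity (-q; q)_oo (q; q^2)_oo = 1 gives the last expression.

    Both infinite identities are limits of finite ones.  With the Gaussian
    binomial [n, m],
      sum_m [n, m] Q^(m(m-1)/2) (-t)^m (a; Q)_m (a t Q^m; Q)_(n-m) = (t; Q)_n
    and
      sum_(-n <= k <= m) [m+n, n+k] a^(k(k+1)/2) b^(k(k-1)/2)
        = (-a; Q)_m (-b; Q)_n      where Q = a b
    follow from Pascal's rule by induction ([finite_1phi1],
    [finite_jacobi_triple]).  No division by a, b or t occurs, so that the
    degenerate case q = 0 needs no separate treatment.  The passage to the
    limit is Tannery's theorem ([tannery]): the Gaussian binomials are
    uniformly bounded because (Q; Q)_n converges to a nonzero limit
    ([qbinom_bounded]), and the remaining factors are dominated by a multiple
    of the convergent series of r^n s^(n(n-1)/2), with s < 1. *)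

(** * Finite q-identities *)

Section QPochhammer.
Variable K : numFieldType.
Implicit Types (a b q t : K) (n m : nat).

Lemma qpoch0 a q : qpoch a q 0 = 1.
Proof. by rewrite /qpoch big_ord0. Qed.

Lemma qpochS a q n : qpoch a q n.+1 = qpoch a q n * (1 - a * q ^+ n).
Proof. by rewrite /qpoch big_ord_recr. Qed.

Lemma qpochSl a q n : qpoch a q n.+1 = (1 - a) * qpoch (a * q) q n.
Proof.
rewrite /qpoch big_ord_recl expr0 mulr1; congr (_ * _).
by apply: eq_bigr => i _; rewrite -mulrA -exprS.
Qed.

Lemma qpochD a q m n : qpoch a q (m + n) = qpoch a q m * qpoch (a * q ^+ m) q n.
Proof.
rewrite /qpoch big_split_ord /=; congr (_ * _).
by apply: eq_bigr => i _; rewrite exprD mulrA.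
Qed.

Lemma qpoch_double a q n :
  qpoch a q (2 * n) = qpoch a (q ^+ 2) n * qpoch (a * q) (q ^+ 2) n.
Proof.
elim: n => [|n IH]; first by rewrite muln0 !qpoch0 mulr1.
have -> : (2 * n.+1 = (2 * n).+2)%N by lia.
rewrite !qpochS IH -!exprM [q ^+ (2 * n).+1]exprS.
by ring.
Qed.

Lemma qpochM_opp a q n :
  qpoch a q n * qpoch (- a) q n = qpoch (a ^+ 2) (q ^+ 2) n.
Proof.
rewrite /qpoch -big_split /=; apply: eq_bigr => i _.
by rewrite -exprM mulnC exprM; ring.
Qed.

Lemma qpoch_neq0 a q n :
  (forall j, a * q ^+ j != 1) -> qpoch a q n != 0.
Proof.
move=> h; rewrite /qpoch prodf_seq_neq0; apply/allP => j _ /=.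
by rewrite subr_eq0 eq_sym h.
Qed.

(** The Gaussian binomial coefficient.  It is a quotient of products (q; q)_n, and not a
    recursively defined polynomial in q, so that its limits and bounds can be
    read off theirs. *)
Definition qbinom q n m : K :=
  if (m <= n)%N then qpoch q q n / (qpoch q q m * qpoch q q (n - m)) else 0.

Section Finite.
Variable q : K.
Hypothesis q_nroot : forall j, q ^+ j.+1 != 1.

Let qqn n : qpoch q q n != 0.
Proof. by apply: qpoch_neq0 => j; rewrite -exprS. Qed.

Let qq1 n : 1 - q ^+ n.+1 != 0.
Proof. by rewrite subr_eq0 eq_sym. Qed.

Lemma qbinomn0 n : qbinom q n 0 = 1.
Proof. by rewrite /qbinom leq0n subn0 qpoch0 mul1r divff. Qed.

Lemma qbinom_gt n m : (n < m)%N -> qbinom q n m = 0.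
Proof. by rewrite /qbinom ltnNge => /negbTE ->. Qed.

Lemma qbinomnn n : qbinom q n n = 1.
Proof. by rewrite /qbinom leqnn subnn qpoch0 mulr1 divff. Qed.

Lemma qbinomS n m :
  qbinom q n.+1 m.+1 = qbinom q n m + q ^+ m.+1 * qbinom q n m.+1.
Proof.
have [lt_mn|lt_nm|->] := ltngtP m n.
- have [d ->] : exists d, n = (m + d).+1.
    by exists (n - m.+1)%N; rewrite -addSn subnKC.
  rewrite /qbinom !ltnS leq_addr (leq_trans (leq_addr d m)) //.
  rewrite !subSS !addKn -addnS addKn addnS !qpochS -!exprS.
  have -> : q ^+ (m + d).+2 = q ^+ m.+1 * q ^+ d.+1 by rewrite -exprD addSn addnS.
  by field; rewrite !qqn !qq1.
- by rewrite !qbinom_gt ?mulr0 ?addr0 // ltnW.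
- by rewrite !qbinomnn qbinom_gt // mulr0 addr0.
Qed.

Lemma qbinomS_compl n m : (m <= n)%N ->
  qbinom q n.+1 m.+1 = qbinom q n m.+1 + q ^+ (n - m) * qbinom q n m.
Proof.
rewrite leq_eqVlt => /orP[/eqP ->|lt_mn].
  by rewrite !qbinomnn qbinom_gt // subnn expr0 mulr1 add0r.
have [d ->] : exists d, n = (m + d).+1.
  by exists (n - m.+1)%N; rewrite -addSn subnKC.
rewrite /qbinom !ltnS leq_addr (leq_trans (leq_addr d m)) //.
rewrite !subSS !addKn -addnS addKn addnS !qpochS -!exprS.
have -> : q ^+ (m + d).+2 = q ^+ m.+1 * q ^+ d.+1 by rewrite -exprD addSn addnS.
by field; rewrite !qqn !qq1.
Qed.

(** Pascal's rule in summed form is the induction step of each finite identity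
    below: only the bracket on the right has to be computed. *)
Lemma sum_qbinomS (F : nat -> K) n :
  \sum_(m < n.+2) qbinom q n.+1 m * F m =
  \sum_(m < n.+1) qbinom q n m * (q ^+ m * F m + F m.+1).
Proof.
rewrite big_ord_recl /= qbinomn0 mul1r.
under eq_bigr => m _ do rewrite /bump add1n qbinomS mulrDl.
rewrite big_split /= addrCA addrC.
under [RHS]eq_bigr => m _ do rewrite mulrDr.
rewrite [RHS]big_split /=; congr (_ + _).
rewrite [RHS]big_ord_recl [in LHS]big_ord_recr /= qbinomn0 (@qbinom_gt n n.+1) //.
rewrite expr0 !mul1r mulr0 mul0r addr0; congr (_ + _).
by apply: eq_bigr => i _; rewrite /bump add1n; ring.
Qed.

Lemma sum_qbinomS_compl (F : nat -> K) n :
  \sum_(m < n.+2) qbinom q n.+1 m * F m =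
  \sum_(m < n.+1) qbinom q n m * (F m + q ^+ (n - m) * F m.+1).
Proof.
rewrite big_ord_recl /= qbinomn0 mul1r.
under eq_bigr => m _ do
  rewrite /bump add1n qbinomS_compl ?leq_ord // mulrDl.
rewrite big_split /= addrA.
under [RHS]eq_bigr => m _ do rewrite mulrDr.
rewrite [RHS]big_split /=; congr (_ + _); last first.
  by apply: eq_bigr => i _; ring.
rewrite [RHS]big_ord_recl [in LHS]big_ord_recr /= qbinomn0 (@qbinom_gt n n.+1) //.
by rewrite mul0r addr0 mul1r.
Qed.

(** A terminating form of the summation of 1phi1, by induction on n with t
    generalized.  Pascal's rule turns the summand for n + 1 and t into the
    summand for n and t q, multiplied by (1 - a t q^m) - t (1 - a q^m) = 1 - t,
    which does not depend on m. *)
Lemma finite_1phi1 a t n :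
  \sum_(m < n.+1) qbinom q n m *
     (q ^+ 'C(m, 2) * (- t) ^+ m * qpoch a q m
       * qpoch (a * t * q ^+ m) q (n - m))
  = qpoch t q n.
Proof.
elim: n t => [|n IH] t.
  by rewrite big_ord_recl big_ord0 qbinomn0 bin0n subnn !qpoch0 !mulr1 addr0.
rewrite (sum_qbinomS (fun m => q ^+ 'C(m, 2) * (- t) ^+ m * qpoch a q m
  * qpoch (a * t * q ^+ m) q (n.+1 - m))) qpochSl -IH big_distrr /=.
apply: eq_bigr => -[m] /= le_mn _.
rewrite subSS subSn // qpochSl qpochS binS bin1 !exprD.
have -> : a * t * q ^+ m * q = a * t * q ^+ m.+1 by rewrite exprS; ring.
have -> : a * (t * q) * q ^+ m = a * t * q ^+ m.+1 by rewrite exprS; ring.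
have -> : (- (t * q)) ^+ m = (- t) ^+ m * q ^+ m by rewrite -mulNr exprMn.
rewrite [(- t) ^+ m.+1]exprS; ring.
Qed.

End Finite.

(** The floor in k (k + 1) / 2 is exact, and the quotient is nonnegative. *)
Lemma theta_exponent (k : int) : (`|(k * (k + 1) %/ 2)%Z|%N)%:Z * 2 = k * (k + 1).
Proof.
(* k is even or odd; accordingly 2 divides k or k + 1. *)
have k2 : (2 %| k * (k + 1))%Z.
  apply/dvdzP; have [j [->|->]] : exists j : int, k = j * 2 \/ k = j * 2 + 1.
  - exists (k %/ 2)%Z; have := divz_eq k 2.
    have := modz_ge0 k (isT : (2 : int) != 0).
    by have := ltz_pmod k (isT : 0 < (2 : int)); lia.
  - by exists (j * (j * 2 + 1)); ring.
  - by exists ((j * 2 + 1) * (j + 1)); ring.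
rewrite abszE ger0_norm ?divzK // divz_ge0 //.
have [k0|k0] := leP 0 k; first by rewrite mulr_ge0 // addr_ge0.
by apply: mulr_le0; lia.
Qed.

Lemma theta_exponent_pred (k : int) :
  (`|(k * (k - 1) %/ 2)%Z|%N)%:Z * 2 = k * (k - 1).
Proof.
have := theta_exponent (k - 1).
by rewrite subrK [(k - 1) * k]mulrC.
Qed.

(** In terms of Q = a b, consecutive terms satisfy t_(k+1) = a Q^k t_k.  The
    power Q^(m-k) clears the negative exponent that this has when k < 0. *)
Lemma theta_termS a b (k : int) (p m : nat) : p%:Z = m%:Z - k ->
  (a * b) ^+ p * theta_term a b (k + 1) = a * (a * b) ^+ m * theta_term a b k.
Proof.
move=> pmk; rewrite /theta_term !exprMn.
have e1 := theta_exponent (k + 1); have e2 := theta_exponent k.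
have e3 := theta_exponent_pred (k + 1); have e4 := theta_exponent_pred k.
move: e1 e2 e3 e4.
set x1 := `|(_ %/ _)%Z|%N; set x2 := `|(_ %/ _)%Z|%N.
set x3 := `|(_ %/ _)%Z|%N; set x4 := `|(_ %/ _)%Z|%N.
move=> e1 e2 e3 e4.
have px : (p + x1 = m.+1 + x2)%N by nia.
have py : (p + x3 = m + x4)%N by nia.
transitivity (a ^+ (p + x1) * b ^+ (p + x3)); first by rewrite !exprD; ring.
by rewrite px py !exprD exprS; ring.
Qed.

Lemma theta_termN a b (k : int) : theta_term a b (- k) = theta_term b a k.
Proof.
rewrite /theta_term mulrC.
have -> : - k * (- k - 1) = k * (k + 1) by ring.
by have -> : - k * (- k + 1) = k * (k - 1) by ring.
Qed.

Lemma theta_term_nat a b n :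
  theta_term a b n%:Z = a ^+ n * (a * b) ^+ 'C(n, 2).
Proof.
elim: n => [|n IH]; first by rewrite /theta_term bin0n !expr0 !mul1r.
have /(@theta_termS a b n%:Z 0 n) : 0%N%:Z = n%:Z - n%:Z by rewrite subrr.
rewrite expr0 mul1r => step; have -> : n.+1%:Z = n%:Z + 1 by lia.
rewrite step.
by rewrite IH binS bin1 exprS exprD; ring.
Qed.

(** The two factors on the right grow independently.  Increasing m multiplies
    every summand by 1 + a (a b)^m, by the second form of Pascal's rule;
    increasing n multiplies every summand by 1 + b (a b)^n, by the first form
    and the symmetry that exchanges a and b. *)
Lemma finite_jacobi_triple a b m n :
  (forall j, (a * b) ^+ j.+1 != 1) ->
  \sum_(k < (m + n).+1) qbinom (a * b) (m + n) k * theta_term a b (k%:Z - n%:Z)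
  = qpoch (- a) (a * b) m * qpoch (- b) (a * b) n.
Proof.
move=> nroot; elim: n => [|n IHn].
  rewrite addn0 qpoch0 mulr1; elim: m => [|m IHm].
    rewrite big_ord_recl big_ord0 qbinomn0 // qpoch0 addr0 subr0.
    by rewrite theta_term_nat bin0n !expr0 !mulr1.
  rewrite (sum_qbinomS_compl nroot (fun k => theta_term a b (k%:Z - 0))) //.
  rewrite qpochS -IHm [RHS]mulrC big_distrr /=.
  apply: eq_bigr => -[k] /= le_km _; rewrite !subr0.
  have pk : (m - k)%N%:Z = m%:Z - k%:Z by rewrite -subzn.
  rewrite -addn1 PoszD (theta_termS a b pk); ring.
rewrite addnS (sum_qbinomS nroot (fun k => theta_term a b (k%:Z - n.+1%:Z))) //.
rewrite qpochS mulrA -IHn [RHS]mulrC big_distrr /=.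
apply: eq_bigr => -[k] /= _ _.
have -> : k.+1%:Z - n.+1%:Z = k%:Z - n%:Z by lia.
have -> : k%:Z - n.+1%:Z = - ((n%:Z - k%:Z) + 1) by lia.
have pk : k%:Z = n%:Z - (n%:Z - k%:Z) by lia.
have := theta_termS b a pk.
rewrite theta_termN (mulrC b a) => ->.
by rewrite -[theta_term b a _]theta_termN opprB; ring.
Qed.

End QPochhammer.

(** * Sequences and series of complex numbers *)

Import ComplexField.Normc.
Section ComplexSequences.
Variable R : realType.
Notation C := (R[i] : numFieldType).

Lemma cvg_ext (T : topologicalType) (x y : nat -> T) (l : T) :
  x =1 y -> x @ \oo --> l -> y @ \oo --> l.
Proof. by move=> /funext ->. Qed.

Lemma normcE (z : C) : `|z| = (normc z)%:C.
Proof. by []. Qed.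

Lemma normc_ge0 (z : C) : 0 <= normc z.
Proof. by rewrite -ler0c -normcE. Qed.

Lemma normc_distC (x y : C) : normc (x - y) = normc (y - x).
Proof. by apply: complexI; rewrite -!normcE distrC. Qed.

Lemma normcX (x : C) n : normc (x ^+ n) = normc x ^+ n.
Proof. by apply: complexI; rewrite rmorphXn /= -!normcE normrX. Qed.

Lemma normc_sum n (F : 'I_n -> C) :
  normc (\sum_(i < n) F i) <= \sum_(i < n) normc (F i).
Proof.
rewrite -lecR -normcE rmorph_sum; exact: ler_norm_sum.
Qed.

(** The norm of [R[i]] takes its values in [R[i]]; [normc] is the same norm with
    real values.  This lemma brings complex limits back to real ones. *)
Lemma cvg_normcP (x : nat -> C) (l : C) :
  x @ \oo --> l <-> (fun n => normc (x n - l)) @ \oo --> (0 : R).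
Proof.
split=> [/cvgrPdist_lt xl|/cvgrPdist_lt xl]; apply/cvgrPdist_lt => e e0.
  have := xl e%:C; rewrite ltcR => /(_ e0).
  apply: filterS => n; rewrite normcE ltcR sub0r normrN ger0_norm ?normc_ge0 //.
  by rewrite normc_distC.
(* A positive complex number is a positive real one. *)
case: e e0 => e i; rewrite ltcE /= => /andP[/eqP -> e0].
have := xl e e0; apply: filterS => n.
rewrite sub0r normrN ger0_norm ?normc_ge0 // normc_distC => xe.
by rewrite normcE complexr0 ltcR.
Qed.

Lemma squeeze_to0 (x y : nat -> R) :
  (forall n, 0 <= x n <= y n) -> y @ \oo --> 0 -> x @ \oo --> 0.
Proof.
move=> xy y0; apply: (@squeeze_cvgr _ _ _ _ (fun=> 0) y) => //.
  exact: nearW.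
exact: cvg_cst.
Qed.

Lemma cvg_lim_eq (x : nat -> C) (l : C) : x @ \oo --> l -> limn x = l.
Proof. by apply: cvg_lim; exact: norm_hausdorff. Qed.

Lemma cvg_uniq (x : nat -> C) (l l' : C) :
  x @ \oo --> l -> x @ \oo --> l' -> l = l'.
Proof. by move=> /cvg_lim_eq <- /cvg_lim_eq. Qed.

Lemma real_abs_series_cvg (x g : nat -> R) :
  (forall n, `|x n| <= g n) -> cvgn (series g) -> cvgn (series x).
Proof.
move=> xg cg; apply: normed_cvg.
by apply: (series_le_cvg _ _ xg cg) => n //; apply: le_trans (xg n).
Qed.

Lemma Re_normc (z : C) : `|complex.Re z| <= normc z.
Proof.
by case: z => a b /=; rewrite -sqrtr_sqr ler_wsqrtr // lerDl sqr_ge0.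
Qed.

Lemma Im_normc (z : C) : `|complex.Im z| <= normc z.
Proof.
by case: z => a b /=; rewrite -sqrtr_sqr ler_wsqrtr // lerDr sqr_ge0.
Qed.

Lemma normc_le (z : C) : normc z <= `|complex.Re z| + `|complex.Im z|.
Proof.
case: z => a b /=.
rewrite -[leRHS]ger0_norm ?addr_ge0 // -sqrtr_sqr ler_wsqrtr // sqrrD.
by rewrite !real_normK ?num_real // addrAC lerDl mulrn_wge0 // mulr_ge0.
Qed.

Lemma Re_sum n (F : 'I_n -> C) : complex.Re (\sum_(i < n) F i) =
  \sum_(i < n) complex.Re (F i).
Proof. exact: (raddf_sum (@complex.Re R : Rcomplex R -> R)). Qed.

Lemma Im_sum n (F : 'I_n -> C) : complex.Im (\sum_(i < n) F i) =
  \sum_(i < n) complex.Im (F i).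
Proof. exact: (raddf_sum (@complex.Im R : Rcomplex R -> R)). Qed.

(** Comparison with a real series, through the real and imaginary parts; this
    is where the completeness of the complex numbers is used. *)
Lemma dominated_series_cvg (x : nat -> C) (g : nat -> R) :
  (forall n, normc (x n) <= g n) -> cvgn (series g) -> cvgn (series x).
Proof.
move=> xg cg.
have cre : cvgn (series (fun n => complex.Re (x n))).
  by apply: real_abs_series_cvg cg => n; apply: le_trans (Re_normc _) (xg n).
have cim : cvgn (series (fun n => complex.Im (x n))).
  by apply: real_abs_series_cvg cg => n; apply: le_trans (Im_normc _) (xg n).
move: cre cim => /cvg_ex[/= a xa] /cvg_ex[/= b xb].
apply: (cvgP (a +i* b : C)); apply/cvg_normcP.
have dist0 (f : nat -> R) l : f @ \oo --> l -> (fun n => `|f n - l|) @ \oo --> 0.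
  move=> fl; rewrite -(@normr0 _ R) -(subrr l); apply: cvg_norm.
  by apply: cvgB => //; exact: cvg_cst.
have ab0 : (fun n => `|series (fun n => complex.Re (x n)) n - a|
               + `|series (fun n => complex.Im (x n)) n - b|) @ \oo --> (0 : R).
  by rewrite -[X in _ --> X]addr0; apply: cvgD; exact: dist0.
refine (squeeze_to0 _ ab0) => n.
rewrite normc_ge0 /=; apply: le_trans (normc_le _) _.
rewrite !seriesEord /=.
rewrite -Re_sum -Im_sum.
by case: (\sum_(_ < _) _) => c d.
Qed.

Lemma series_le_lim (g : nat -> R) n :
  (forall n, 0 <= g n) -> cvgn (series g) -> series g n <= limn (series g).
Proof.
by move=> g0 cg; apply: nondecreasing_cvgn_le => //; exact: nondecreasing_series.
Qed.

(** Tannery's theorem for nonnegative arrays with zero limits: a finite head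
    tends to 0 termwise, and the rest is at most a tail of the series of g. *)
Lemma tannery_null (w : nat -> nat -> R) (g : nat -> R) :
  (forall k, w ^~ k @ \oo --> 0) ->
  (forall n k, (k <= n)%N -> 0 <= w n k <= g k) ->
  cvgn (series g) ->
  (fun n => \sum_(k < n.+1) w n k) @ \oo --> 0.
Proof.
move=> w0 wg cg.
have g0 k : 0 <= g k by have /andP[] := wg k k (leqnn k); exact: le_trans.
apply/cvgrPdist_lt => e e0.
have e20 : 0 < e / 2 by rewrite divr_gt0.
have /cvgrPdist_lt/(_ _ e20)[N _ /(_ N (leqnn N)) tail] := cg.
have head : (fun n => \sum_(k < N) w n k) @ \oo --> \sum_(k < N) (0 : R).
  apply: (@cvg_big _ _ _ _ _ _ _ _ _ (fun i n => w n (nat_of_ord i))).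
    exact: add_continuous.
  by move=> i _; exact: w0.
rewrite big1_eq in head; have /cvgrPdist_lt/(_ _ e20) := head.
move=> headn; near=> n.
have ltNn : (N <= n.+1)%N by near: n; exists N => // n /=; exact: leqW.
rewrite sub0r normrN ger0_norm; last first.
  by apply: sumr_ge0 => -[k] /= kn _; have /andP[] := wg n k kn.
rewrite -(big_mkord xpredT (w n)) (big_cat_nat (leq0n N) ltNn) /=.
rewrite [e]splitr ltr_leD //.
  rewrite big_mkord.
  have : `|0 - \sum_(k < N) w n k| < e / 2 by near: n.
  by rewrite sub0r normrN; apply: le_lt_trans; exact: ler_norm.
apply: le_trans (ltW tail).
apply: le_trans (ler_norm _).
rewrite lerBrDl.
apply: le_trans (series_le_lim n.+1 g0 cg).
rewrite /series /= (big_cat_nat (leq0n N) ltNn) /= lerD2l.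
rewrite !big_nat; apply: ler_sum => k /andP[_ kn].
by have /andP[] := wg n k kn.
Unshelve. all: by end_near. Qed.

(** Tannery's theorem, that is, dominated convergence for series.  *)
Lemma tannery (u : nat -> nat -> C) (v : nat -> C) (g : nat -> R) :
  (forall k, u ^~ k @ \oo --> v k) ->
  (forall n k, (k <= n)%N -> normc (u n k) <= g k) ->
  cvgn (series g) ->
  cvgn (series v) /\
  (fun n => \sum_(k < n.+1) u n k) @ \oo --> limn (series v).
Proof.
move=> uv ug cg.
have vg k : normc (v k) <= g k.
  apply/ler_addgt0Pr => e e0.
  have /cvg_normcP/cvgrPdist_lt/(_ _ e0) [N _ /(_ (maxn N k))] := uv k.
  rewrite /= leq_maxl sub0r normrN ger0_norm ?normc_ge0 // => /(_ isT) lt_e.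
  rewrite -[v k](subKr (u (maxn N k) k)).
  apply: le_trans (le_normcD _ _) _; rewrite normcN.
  by apply: lerD; [apply: ug; exact: leq_maxr | exact: ltW].
have cv : cvgn (series v) := dominated_series_cvg vg cg.
split=> //.
have cv1 : (fun n => series v n.+1) @ \oo --> limn (series v).
  by rewrite (cvg_shiftS (series v)).
suff d0 : (fun n => \sum_(k < n.+1) u n k - series v n.+1) @ \oo --> (0 : C).
  rewrite -[X in _ --> X]add0r.
  by apply: cvg_ext (cvgD d0 cv1) => n /=; rewrite subrK.
apply/cvg_normcP.
have w0 : (fun n => \sum_(k < n.+1) normc (u n k - v k)) @ \oo --> (0 : R).
  apply: (@tannery_null (fun n k => normc (u n k - v k)) (fun k => g k + g k)).
  - by move=> k; have /cvg_normcP := uv k.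
  - move=> n k kn; rewrite normc_ge0 /=; apply: le_trans (le_normcD _ _) _.
    by rewrite normcN lerD // ug.
  - exact: is_cvg_seriesD.
refine (squeeze_to0 _ w0) => n.
by rewrite normc_ge0 /= subr0 seriesEord -sumrB normc_sum.
Qed.

(** The partial products P_n stay bounded because 1 + x <= exp x, and then the
    series of the differences P_(n+1) - P_n = P_n y_n converges absolutely. *)
Lemma dominated_prod_cvg (y : nat -> C) (g : nat -> R) :
  (forall n, normc (y n) <= g n) -> cvgn (series g) ->
  cvgn (fun n => \prod_(j < n) (1 + y j)).
Proof.
move=> yg cg.
have g0 k : 0 <= g k by apply: le_trans (yg k); exact: normc_ge0.
pose P n := \prod_(j < n) (1 + y j).
have Pb n : normc (P n) <= expR (series g n).
  rewrite /P seriesEord expR_sum; elim: n => [|n IH].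
    by rewrite !big_ord0 normc1.
  rewrite !big_ord_recr /= normcM ler_pM ?normc_ge0 //.
  apply: le_trans (le_normcD _ _) _; rewrite normc1.
  by apply: le_trans (expR_ge1Dx _); rewrite lerD2l.
have : cvgn (series (fun n => P n * y n)).
  apply: (@dominated_series_cvg _ (expR (limn (series g)) *: g)).
    move=> n; rewrite normcM ler_pM ?normc_ge0 //.
    by apply: le_trans (Pb n) _; rewrite ler_expR series_le_lim.
  exact: is_cvg_seriesZ.
move=> /cvg_ex[l Pl]; apply: (cvgP (1 + l)).
apply: cvg_ext (cvgD (cvg_cst (1 : C)) Pl) => n.
rewrite -[LHS]/(1 + series _ n).
elim: n => [|n IH]; first by rewrite seriesEord /= !big_ord0 addr0.
by rewrite seriesSr addrA IH big_ord_recr /= -/(P n) mulrDr mulr1.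
Qed.

Lemma cvg_normc_bounded (x : nat -> C) : cvgn x ->
  exists2 B : R, 0 < B & forall n, normc (x n) <= B.
Proof.
move=> /cvg_seq_bounded [M [Mr xM]].
have [m Mm] : exists m : R, M = m%:C by exact/complex_realP.
exists (`|m| + 1); first by rewrite ltr_wpDl.
move=> n; rewrite -lecR -normcE; apply: xM => //.
by rewrite Mm ltcR ltr_pwDr // ler_norm.
Qed.

(** From some index N on, the ratios are below 1/2 and the series is dominated
    by a geometric one. *)
Lemma ratio_series_cvg (x c : nat -> R) :
  (forall n, 0 <= x n) -> (forall n, x n.+1 <= c n * x n) -> c @ \oo --> 0 ->
  cvgn (series x).
Proof.
move=> x0 xc c0.
have half_gt0 : 0 < 2^-1 :> R by rewrite invr_gt0.
have /cvgrPdist_lt/(_ _ half_gt0)[N _ cN] := c0.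
have xN n : x (n + N)%N <= geometric (x N) 2^-1 n.
  elim: n => [|n IH]; first by rewrite /= expr0 mulr1.
  rewrite addSn; apply: le_trans (xc _) _; rewrite /= exprS mulrCA.
  apply: le_trans (ler_wpM2l (ltW half_gt0) IH); apply: ler_wpM2r => //.
  have := cN (n + N)%N (leq_addl _ _); rewrite sub0r normrN => cn.
  by apply: le_trans (ler_norm _) (ltW cn).
have /cvg_ex[l xl] : cvgn (series (fun n => x (n + N)%N)).
  apply: (series_le_cvg _ _ xN) => [n|n|] //=.
    by rewrite mulr_ge0 // exprn_ge0 // ltW.
  apply: is_cvg_geometric_series.
  by rewrite ger0_norm ?ltW // invf_lt1 // ltr1n.
apply: (cvgP (series x N + l)); rewrite -(cvg_shiftn N).
apply: cvg_ext (cvgD (cvg_cst (series x N)) xl) => n.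
rewrite -[LHS]/(series x N + series _ n) /=.
elim: n => [|n IH]; first by rewrite !seriesEord /= big_ord0 addr0.
by rewrite addSn !seriesSr addrA IH.
Qed.

Lemma is_cvg_series_shift (x : nat -> R) :
  cvgn (series x) -> cvgn (series (fun n => x n.+1)).
Proof.
move=> /cvg_ex[l]; rewrite -cvg_shiftS => xl; apply: (cvgP (l - x 0%N)).
apply: cvg_ext (cvgB xl (cvg_cst (x 0%N))) => n.
by rewrite -[LHS]/(series x n.+1 - x 0%N) !seriesEord /= big_ord_recl addrC addKr.
Qed.

End ComplexSequences.

(** * Infinite q-products and q-series *)

Section QSeries.
Variable R : realType.
Notation C := (R[i] : numFieldType).
Implicit Types a b c p q r s t : C.

Lemma normc_lt1 q : (`|q| < 1) = (normc q < 1).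
Proof. exact: (ltcR (normc q) 1). Qed.

Lemma expr_neq1 q : `|q| < 1 -> forall j, q ^+ j.+1 != 1.
Proof.
move=> q1 j; apply/eqP => /(congr1 (fun x => `|x|)).
have : `|q| ^+ j.+1 < 1 by rewrite exprn_ilt1.
by rewrite normrX normr1 => + e; rewrite e ltxx.
Qed.

Lemma cvg_mul_expr a q : `|q| < 1 -> (fun n => a * q ^+ n) @ \oo --> (0 : C).
Proof.
rewrite normc_lt1 => q1; apply/cvg_normcP.
have q1' : `|normc q| < 1 by rewrite ger0_norm ?normc_ge0.
apply: cvg_ext (cvg_geometric (normc a) q1') => n.
by rewrite subr0 normcM normcX.
Qed.

Lemma qpoch_cvg a q : `|q| < 1 -> qpoch a q @ \oo --> qpoch_inf a q.
Proof.
rewrite normc_lt1 => q1; rewrite /qpoch_inf.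
apply: (@dominated_prod_cvg _ (fun j => - (a * q ^+ j))
    (geometric (normc a) (normc q))).
  by move=> n; rewrite normcN normcM normcX.
by apply: is_cvg_geometric_series; rewrite ger0_norm ?normc_ge0.
Qed.
Arguments qpoch_cvg a [q].

Lemma qpoch_cvg_comp a q (h : nat -> nat) k : `|q| < 1 ->
  (forall n, (n <= h n + k)%N) ->
  (fun n => qpoch a q (h n)) @ \oo --> qpoch_inf a q.
Proof.
move=> q1 hk; have hoo : h @ \oo --> \oo.
  move=> A [N _ NA]; exists (N + k)%N => // n /= Nn; apply: NA => /=.
  by have := hk n; lia.
exact: (cvg_comp _ _ hoo (qpoch_cvg a q1)).
Qed.

(** Limit of an identity between finite products; h allows a doubled
    number of factors on the right. *)
Lemma qpoch_infM a p b r c s (h : nat -> nat) :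
  `|p| < 1 -> `|r| < 1 -> `|s| < 1 -> (forall n, (n <= h n)%N) ->
  (forall n, qpoch a p n * qpoch b r n = qpoch c s (h n)) ->
  qpoch_inf a p * qpoch_inf b r = qpoch_inf c s.
Proof.
move=> p1 r1 s1 hn e.
have lhs : (fun n => qpoch a p n * qpoch b r n) @ \oo -->
    qpoch_inf a p * qpoch_inf b r.
  by apply: cvgM; exact: qpoch_cvg.
have rhs : (fun n => qpoch c s (h n)) @ \oo --> qpoch_inf c s.
  by apply: (@qpoch_cvg_comp _ _ _ 0) => // n; rewrite addn0.
by apply: cvg_uniq lhs _; apply: cvg_ext rhs => n.
Qed.

Lemma normX_lt1 q n : `|q| < 1 -> `|q ^+ n.+1| < 1.
Proof. by move=> q1; rewrite normrX exprn_ilt1. Qed.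

Lemma qpoch_inf_double a q : `|q| < 1 ->
  qpoch_inf a (q ^+ 2) * qpoch_inf (a * q) (q ^+ 2) = qpoch_inf a q.
Proof.
move=> q1; apply: (@qpoch_infM _ _ _ _ _ _ (muln 2)) => //; try exact: normX_lt1.
  by move=> n; lia.
by move=> n; rewrite qpoch_double.
Qed.

Lemma qpoch_infM_opp a q : `|q| < 1 ->
  qpoch_inf a q * qpoch_inf (- a) q = qpoch_inf (a ^+ 2) (q ^+ 2).
Proof.
move=> q1; apply: (@qpoch_infM _ _ _ _ _ _ id) => //; first exact: normX_lt1.
by move=> n; rewrite qpochM_opp.
Qed.

(** The reciprocals 1 / (1 - a q^j) = 1 + a q^j / (1 - a q^j) also have a
    convergent product, whose limit is an inverse of (a; q)_oo. *)
Lemma qpoch_inf_neq0 a q : `|q| < 1 -> (forall j, a * q ^+ j != 1) ->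
  qpoch_inf a q != 0.
Proof.
move=> q1 aq.
have f0 j : 1 - a * q ^+ j != 0 by rewrite subr_eq0 eq_sym.
have inv1 : (fun j => (1 - a * q ^+ j)^-1) @ \oo --> (1 : C)^-1.
  apply: cvgV; first exact: oner_neq0.
  rewrite -[X in _ --> X]subr0; apply: cvgB; first exact: cvg_cst.
  exact: cvg_mul_expr.
have [B B0 invB] := cvg_normc_bounded (cvgP _ inv1).
have /cvg_ex[l /= yl] :
    cvgn (fun n => \prod_(j < n) (1 + a * q ^+ j / (1 - a * q ^+ j))).
  apply: (@dominated_prod_cvg _ (fun j => a * q ^+ j / (1 - a * q ^+ j))
    (geometric (normc a * B) (normc q))).
    move=> n; rewrite !normcM normcX /= mulrAC ler_wpM2r ?exprn_ge0 ?normc_ge0 //.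
    by rewrite ler_wpM2l ?normc_ge0.
  apply: is_cvg_geometric_series; rewrite ger0_norm ?normc_ge0 //.
  by rewrite -normc_lt1.
have prod1 : (fun=> 1 : C) @ \oo --> qpoch_inf a q * l.
  apply: cvg_ext (cvgM (qpoch_cvg a q1) yl) => n /=.
  rewrite /qpoch -big_split /= big1 // => j _.
  by field.
have cst1 : (fun=> 1 : C) @ \oo --> (1 : C) by exact: cvg_cst.
apply/eqP => P0; have := cvg_uniq prod1 cst1; rewrite P0 mul0r.
by move/eqP; rewrite eq_sym oner_eq0.
Qed.

(** The series that dominates all the series below: successive terms have the
    ratio r s^n, which tends to 0. *)
Lemma theta_series_cvg (c r s : R) : 0 <= r -> 0 <= s < 1 ->
  cvgn (series (fun n => c * (r ^+ n * s ^+ 'C(n, 2)))).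
Proof.
move=> r0 /andP[s0 s1]; set x := fun n : nat => r ^+ n * s ^+ 'C(n, 2).
have cx : cvgn (series x).
  apply: (@ratio_series_cvg _ _ (geometric r s)).
  - by move=> n; rewrite mulr_ge0 ?exprn_ge0.
  - move=> n; rewrite /x binS bin1 exprS exprD /=.
    by rewrite le_eqVlt; apply/orP; left; apply/eqP; ring.
  - by apply: cvg_geometric; rewrite ger0_norm.
exact: (@is_cvg_seriesZ _ x c cx).
Qed.

Section Base.
Variable q : C.
Hypothesis q1 : `|q| < 1.
Let P := qpoch_inf q q.

Let qqn n : qpoch q q n != 0.
Proof. by apply: qpoch_neq0 => j; rewrite -exprS expr_neq1. Qed.

Let P0 : P != 0.
Proof. by apply: qpoch_inf_neq0 => // j; rewrite -exprS expr_neq1. Qed.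

Lemma qpoch_ratio_bounded a b : (forall j, b * q ^+ j != 1) ->
  exists2 B : R, 0 < B & forall m n, normc (qpoch a q m / qpoch b q n) <= B.
Proof.
move=> bq.
have [A A0 aA] := cvg_normc_bounded (cvgP _ (qpoch_cvg a q1)).
have [B B0 bB] := cvg_normc_bounded
  (cvgP _ (cvgV (qpoch_inf_neq0 q1 bq) (qpoch_cvg b q1))).
exists (A * B); first exact: mulr_gt0.
by move=> m n; rewrite normcM; apply: ler_pM (aA m) (bB n); exact: normc_ge0.
Qed.

(** Together with [qbinom_cvg], what Tannery's theorem requires of the
    Gaussian binomials in the triple product identity. *)
Lemma qbinom_bounded :
  exists2 B : R, 0 < B & forall n m, normc (qbinom q n m) <= B.
Proof.
have qq j : q * q ^+ j != 1 by rewrite -exprS expr_neq1.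
have [A A0 hA] := qpoch_ratio_bounded q qq.
have [B B0 hB] := qpoch_ratio_bounded 0 qq.
exists (A * B); first exact: mulr_gt0.
move=> n m; rewrite /qbinom; case: ifP => _; last first.
  by rewrite normc0 mulr_ge0 // ltW.
rewrite invfM mulrA normcM ler_pM ?normc_ge0 //.
have := hB 0%N (n - m)%N; rewrite qpoch0 mul1r; exact.
Qed.

(** In the limit N, M, N - M -> oo the Gaussian binomial tends to
    1 / (q; q)_oo.  The hypotheses say that these three sequences are at least
    n - k. *)
Lemma qbinom_cvg (N M : nat -> nat) k :
  (forall n, (n <= N n + k)%N) -> (forall n, (n <= M n + k)%N) ->
  (forall n, (n <= N n - M n + k)%N) ->
  (\forall n \near \oo, (M n <= N n)%N) ->
  (fun n => P * qbinom q (N n) (M n)) @ \oo --> (1 : C).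
Proof.
move=> hN hM hNM MN.
have h :
  (fun n => P * (qpoch q q (N n) / (qpoch q q (M n) * qpoch q q (N n - M n))))
   @ \oo --> P * (P / (P * P)).
  apply: cvgM; first exact: cvg_cst.
  apply: cvgM; first exact: qpoch_cvg_comp hN.
  apply: cvgV; first by rewrite mulf_neq0.
  by apply: cvgM; [exact: qpoch_cvg_comp hM | exact: qpoch_cvg_comp hNM].
have -> : (1 : C) = P * (P / (P * P)) by field.
apply: cvg_trans h; apply: near_eq_cvg.
by apply: filterS MN => n; rewrite /qbinom => ->.
Qed.

(** Dividing [finite_1phi1] by (a t; q)_n turns the right-hand side into
    (t; q)_n / (a t; q)_n, and the m-th summand into (q; q)_n / (q; q)_(n-m)
    times the m-th term of the series; that quotient is bounded and tends
    to 1. *)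
Theorem sum_1phi1 a t : (forall j, a * t * q ^+ j != 1) ->
  series (fun n => q ^+ 'C(n, 2) * (- t) ^+ n * qpoch a q n
                   / (qpoch q q n * qpoch (a * t) q n))
    @ \oo --> qpoch_inf t q / qpoch_inf (a * t) q.
Proof.
move=> atq; set v := fun n => _ / _.
have qq j : q * q ^+ j != 1 by rewrite -exprS expr_neq1.
have [A A0 hA] := qpoch_ratio_bounded q qq.
have [B B0 hB] := qpoch_ratio_bounded 0 qq.
have [D D0 hD] := qpoch_ratio_bounded a atq.
have atn n := qpoch_neq0 n atq.
have [|||cv lim] := @tannery _ (fun n m => qpoch q q n / qpoch q q (n - m) * v m) v
  (fun m => A * (B * D) * (normc (- t) ^+ m * normc q ^+ 'C(m, 2))).
- move=> k; rewrite -[X in _ --> X]mul1r.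
  apply: cvgM; last exact: cvg_cst.
  rewrite -(divff P0); apply: cvgM; first exact: qpoch_cvg.
  apply: cvgV => //; apply: (@qpoch_cvg_comp _ _ (fun n => n - k)%N k) => // n.
  by lia.
- move=> n m _; rewrite normcM -[leRHS]mulrA ler_pM ?normc_ge0 //.
  have -> : v m = (1 / qpoch q q m) * (qpoch a q m / qpoch (a * t) q m)
               * ((- t) ^+ m * q ^+ 'C(m, 2)).
    by rewrite /v; field; rewrite qqn atn.
  rewrite -!normcX -normcM [leLHS]normcM.
  rewrite ler_wpM2r ?normc_ge0 // normcM.
  apply: ler_pM (hD m m); rewrite ?normc_ge0 //.
  by have := hB 0%N m; rewrite qpoch0.
- by apply: theta_series_cvg; rewrite normc_ge0 // -normc_lt1.
have fin : (fun n => qpoch t q n / qpoch (a * t) q n) @ \oo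
    --> qpoch_inf t q / qpoch_inf (a * t) q.
  apply: cvgM; first exact: qpoch_cvg.
  by apply: cvgV; [exact: qpoch_inf_neq0 | exact: qpoch_cvg].
suff limE : limn (series v) = qpoch_inf t q / qpoch_inf (a * t) q.
  by rewrite -limE; exact: cv.
apply: cvg_uniq lim _; apply: cvg_ext fin => n.
rewrite -(finite_1phi1 (expr_neq1 q1) a t) big_distrl /=.
apply: eq_bigr => -[m] /= mn _.
rewrite /qbinom -ltnS mn /v.
have -> : qpoch (a * t) q n = qpoch (a * t) q m * qpoch (a * t * q ^+ m) q (n - m).
  by rewrite -qpochD subnKC.
have n0 : qpoch (a * t * q ^+ m) q (n - m) != 0.
  by apply: qpoch_neq0 => j; rewrite -mulrA -exprD.
by field; rewrite !qqn atn n0.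
Qed.

End Base.

(** The limit of [finite_jacobi_triple] with parameters n and n + 1, multiplied
    by (Q; Q)_oo.  The sum is cut at k = 0; with these parameters either half
    has n + 1 terms, and Tannery's theorem applies to each. *)
Theorem jacobi_triple a b : `|a * b| < 1 ->
  ramanujan_theta a b =
  qpoch_inf (- a) (a * b) * qpoch_inf (- b) (a * b) * qpoch_inf (a * b) (a * b).
Proof.
move=> Q1; set Q := a * b; set P := qpoch_inf Q Q.
have [B B0 hB] := qbinom_bounded Q1.
have Qr : 0 <= normc Q < 1 by rewrite normc_ge0 -normc_lt1.
have [|||_ limp] := @tannery _
  (fun n k => P * qbinom Q (n + n.+1) (n.+1 + k) * theta_term a b k%:Z)
  (fun k => theta_term a b k%:Z)
  (fun k => normc P * B * (normc a ^+ k * normc Q ^+ 'C(k, 2))).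
- move=> k; rewrite -[X in _ --> X]mul1r; apply: cvgM; last exact: cvg_cst.
  apply: (@qbinom_cvg _ _ _ _ k) => // [n|n|n|]; try lia.
  by exists k => // n /=; lia.
- move=> n k _; rewrite theta_term_nat -!normcX -normcM.
  rewrite [leLHS]normcM [normc (P * _)]normcM.
  apply: ler_wpM2r; first exact: normc_ge0.
  by apply: ler_wpM2l (hB _ _); exact: normc_ge0.
- by apply: theta_series_cvg => //; exact: normc_ge0.
have [|||_ limm] := @tannery _
  (fun n k => P * qbinom Q (n + n.+1) (n - k) * theta_term a b (Negz k))
  (fun k => theta_term a b (Negz k))
  (fun k => normc P * B * (normc b ^+ k.+1 * normc Q ^+ 'C(k.+1, 2))).
- move=> k; rewrite -[X in _ --> X]mul1r; apply: cvgM; last exact: cvg_cst.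
  apply: (@qbinom_cvg _ _ _ _ k) => // [n|n|n|]; try lia.
  by exists k => // n /=; lia.
- move=> n k _; rewrite NegzE theta_termN theta_term_nat (mulrC b).
  rewrite -!normcX -normcM [leLHS]normcM [normc (P * _)]normcM.
  apply: ler_wpM2r; first exact: normc_ge0.
  by apply: ler_wpM2l (hB _ _); exact: normc_ge0.
- apply: (is_cvg_series_shift
    (x := fun k => normc P * B * (normc b ^+ k * normc Q ^+ 'C(k, 2)))).
  by apply: theta_series_cvg => //; exact: normc_ge0.
rewrite /ramanujan_theta.
apply: cvg_uniq (cvgD limp limm) _.
have fin : (fun n => qpoch (- a) Q n * qpoch (- b) Q n.+1 * P) @ \oo -->
  qpoch_inf (- a) Q * qpoch_inf (- b) Q * P.
  apply: cvgM; last exact: cvg_cst.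
  apply: cvgM; first exact: qpoch_cvg.
  by apply: (@qpoch_cvg_comp _ _ succn 0) => // n; lia.
apply: cvg_ext fin => n.
rewrite -(finite_jacobi_triple n n.+1 (expr_neq1 Q1)) mulrC big_distrr /=.
rewrite -addSn big_split_ord /= addrC; congr (_ + _).
  by apply: eq_bigr => k _; rewrite mulrA PoszD addrC addrA addNr add0r.
(* The terms of negative index occur in increasing order; [Negz k] counts down. *)
rewrite (reindex_inj rev_ord_inj) /=.
apply: eq_bigr => -[k] /= kn _; rewrite subSS mulrA; congr (_ * theta_term _ _ _).
by lia.
Qed.

End QSeries.

(** * The identity *)

Theorem mainTheorem1 (R : realType) (q : (R[i] : numFieldType)) (hq : `|q| < 1) :
  series (fun n : nat =>
      q ^+ (n * (n - 1)) * qpoch (- q) (q ^+ 2) n / qpoch q q (2 * n))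
    @ \oo --> ramanujan_theta 1 (q ^+ 2) / ramanujan_psi (- q)
  /\ ramanujan_theta 1 (q ^+ 2) / ramanujan_psi (- q)
     = qpoch_inf (- q) q * qpoch_inf (- 1) (q ^+ 2).
Proof.
have hqn n : `|q ^+ n.+1| < 1 by exact: normX_lt1.
have q2j j : q * (q ^+ 2) ^+ j != 1 by rewrite -exprM -exprS expr_neq1.
have lhs : series (fun n : nat =>
      q ^+ (n * (n - 1)) * qpoch (- q) (q ^+ 2) n / qpoch q q (2 * n))
    @ \oo --> qpoch_inf (- 1) (q ^+ 2) / qpoch_inf q (q ^+ 2).
  have := @sum_1phi1 _ _ (hqn 1%N) (- q) (- 1).
  rewrite mulrN1 opprK => /(_ q2j); apply: cvg_ext => n.
  apply: eq_bigr => m _.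
  have e2 : (2 * 'C(m, 2) = m * (m - 1))%N.
    by rewrite mulnC (bin_ffact m 2) !ffactnS ffactn0 muln1 subn1.
  by rewrite opprK expr1n mulr1 qpoch_double -exprM e2 -expr2 [X in _ / X]mulrC.
have P2 : qpoch_inf (q ^+ 2) (q ^+ 2) != 0.
  apply: qpoch_inf_neq0 (hqn 1%N) _ => j.
  by rewrite -exprS -exprM mulSn expr_neq1.
have P4 : qpoch_inf (q ^+ 4) (q ^+ 4) != 0.
  apply: qpoch_inf_neq0 (hqn 3%N) _ => j.
  by rewrite -exprS -exprM mulSn expr_neq1.
have Po : qpoch_inf q (q ^+ 2) != 0 := qpoch_inf_neq0 (hqn 1%N) q2j.
(* (-q^2; q^2)_oo (q^2; q^2)_oo = (q^4; q^4)_oo *)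
have theta : ramanujan_theta 1 (q ^+ 2)
    = qpoch_inf (- 1) (q ^+ 2) * qpoch_inf (q ^+ 4) (q ^+ 4).
  have h1 : `|1 * q ^+ 2| < 1 by rewrite mul1r; exact: (hqn 1%N).
  rewrite (jacobi_triple h1) mul1r -mulrA; congr (_ * _).
  by rewrite mulrC (qpoch_infM_opp _ (hqn 1%N)) -!exprM.
(* (q; q^4)_oo (q^3; q^4)_oo = (q; q^2)_oo *)
have psi : ramanujan_psi (- q)
    = qpoch_inf q (q ^+ 2) * qpoch_inf (q ^+ 4) (q ^+ 4).
  have e4 : - q * (- q) ^+ 3 = q ^+ 4 by ring.
  have h4 : `|- q * (- q) ^+ 3| < 1 by rewrite e4; exact: (hqn 3%N).
  rewrite /ramanujan_psi (jacobi_triple h4) e4; congr (_ * _).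
  rewrite opprK; have -> : - (- q) ^+ 3 = q ^+ 3 by ring.
  have := qpoch_inf_double q (hqn 1%N); rewrite -exprM -exprS; exact.
(* (-q; q)_oo (q; q)_oo = (q^2; q^2)_oo and (q; q)_oo = (q; q^2)_oo (q^2; q^2)_oo *)
have euler : qpoch_inf (- q) q * qpoch_inf q (q ^+ 2) = 1.
  apply: (mulIf P2); rewrite mul1r -mulrA.
  have dbl := qpoch_inf_double q hq; rewrite -expr2 in dbl.
  by rewrite dbl mulrC; exact: qpoch_infM_opp.
have ratio : ramanujan_theta 1 (q ^+ 2) / ramanujan_psi (- q)
    = qpoch_inf (- 1) (q ^+ 2) / qpoch_inf q (q ^+ 2).
  by rewrite theta psi -mulf_div divff // mulr1.
rewrite ratio; split; first exact: lhs.
by apply: (canLR (mulfK Po)); rewrite mulrAC euler mul1r.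
Qed.
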